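(* Let $\mathbb{F}$ be a complete normed field and let $\mathcal{F}$ be a gentric sheaf of functions on $\mathbb{F}^d$. Then for every open $U\subseteq\mathbb{F}^d$, every $f\in\mathcal{F}(U)$ is analytic on $U$.
   Context: A norm on a field $\mathbb{F}$ is a function $|\cdot|:\mathbb{F}\to[0,\infty)$ with $|x|=0$ iff $x=0$, $|xy|=|x||y|$, and $|x+y|\le|x|+|y|$; $\mathbb{F}$ is complete if it is complete for the metric $d(x,y)=|x-y|$. A function on an open set is analytic if near each point it is given by a convergent power series. A sheaf of smooth functions on $\mathbb{F}^d$ assigns to each open $U\subseteq\mathbb{F}^d$ a set $\mathcal{F}(U)$ of smooth $\mathbb{F}$-valued functions on $U$, closed under restriction and satisfying the sheaf gluing condition. Here smoothness is used only to the extent that each $f\in\mathcal{F}(U)$ has at each $u\in U$ a formal power series (Taylor series) $\sum_\alpha c_\alpha x^\alpha$ over $\mathbb{F}$ with $f(u+x)=\sum_{|\alpha|\le n}c_\alpha x^\alpha+o(\max_i|x_i|^n)$ as $x\to0$, for every $n$. Such a sheaf $\mathcal{F}$ is pre-gentric if whenever $U$ is open, $u\in U$, $f\in\mathcal{F}(U)$ and the formal power series of $f$ at $u$ is convergent on $U$, then $f$ is equal to (the sum of) its formal power series expansion at $u$ on $U$. A pre-gentric sheaf $\mathcal{F}$ is gentric if there is a spread set $X\subseteq\mathbb{F}^d$ such that for every open $U$, every $u\in U$ and every $f\in\mathcal{F}(U)$, the function $z\mapsto f(u+xz)$ is analytic in the single variable $z$ near $z=0$ for every $x\in X$. Spread sets: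 the Cantor space $2^{\aleph_0}$ is the set of infinite $0$-$1$ sequences, with the metric in which two distinct branches $a,b$ have distance $2^{-n}$, where $n$ is the depth to which they agree, and with the natural measure giving the set of branches extending a given bitstring of length $n$ measure $2^{-n}$; powers carry the product measure. An embedding $\iota:2^{\aleph_0}\to\mathbb{F}$ is spread if there are $C,\gamma>0$ with $d(\iota(x),\iota(y))\ge C\,d(x,y)^\gamma$ for all $x,y$. A set $Y\subseteq\mathbb{F}^k$ is affine-spread if there are spread embeddings $\iota_1,\dots,\iota_k$ such that, for $\iota=\iota_1\times\dots\times\iota_k$, $\iota^{-1}(Y)$ has positive outer measure in $(2^{\aleph_0})^k$. A set $X\subseteq\mathbb{F}^d$ is spread if $\{(x_2/x_1,\dots,x_d/x_1):(x_1,\dots,x_d)\in X,\ x_1\neq0\}\subseteq\mathbb{F}^{d-1}$ is affine-spread. *)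

(* Defs.v *)
From HB Require Import structures.
From mathcomp Require Import all_boot all_order all_algebra.
From mathcomp Require Import all_classical all_reals all_analysis.
From mathcomp Require summability.

Set Implicit Arguments.
Unset Strict Implicit.
Unset Printing Implicit Defensive.
Import Order.TTheory GRing.Theory Num.Theory.
Local Open Scope classical_set_scope.
Local Open Scope ring_scope.

(* The library's norms satisfy `|x *+ n| = `|x| *+ n, which excludes
   non-archimedean absolute values, hence a structure of its own. *)
Record normedFieldType (R : realType) := NormedFieldType {
  normed_field : fieldType ;
  absv : normed_field -> R ;
  absv_ge0 : forall x, 0 <= absv x ;
  absv_eq0P : forall x, absv x = 0 <-> x = 0 ;
  absvM : forall x y, absv (x * y) = absv x * absv y ;
  ler_absvD : forall x y, absv (x + y) <= absv x + absv y
}.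

Definition normed_field_sort (R : realType) (F : normedFieldType R) : Type :=
  normed_field F.
Coercion normed_field_sort : normedFieldType >-> Sortclass.

HB.instance Definition _ (R : realType) (F : normedFieldType R) :=
  GRing.Field.copy (normed_field_sort F) (normed_field F).
HB.instance Definition _ (R : realType) (F : normedFieldType R) :=
  isPointed.Build (normed_field_sort F) 0.

Section metric.
Context {R : realType} {F : normedFieldType R}.

Definition absv_dist (x y : F) : R := absv (x - y).

Fact absv_distxx x : absv_dist x x = 0.
Proof. by rewrite /absv_dist subrr; apply/absv_eq0P. Qed.

Fact absv_dist_positivity x y : absv_dist x y = 0 -> x = y.
Proof. by move=> /absv_eq0P/eqP; rewrite subr_eq0 => /eqP. Qed.

Fact absv_dist_sym x y : absv_dist x y = absv_dist y x.
Proof.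
have absv1 : absv (1 : F) = 1.
  have n0 : absv (1 : F) != 0.
    by apply/eqP => /absv_eq0P/eqP; rewrite oner_eq0.
  by apply: (mulfI n0); rewrite -absvM !mulr1.
have absvN1 : absv (-1 : F) = 1.
  apply/eqP; rewrite -(@pexpr_eq1 _ _ 2)// ?absv_ge0//.
  by rewrite expr2 -absvM mulrNN mulr1 absv1.
by rewrite /absv_dist -opprB -mulN1r absvM absvN1 mul1r.
Qed.

Fact absv_dist_triangle y x z :
  absv_dist x z <= absv_dist x y + absv_dist y z.
Proof.
rewrite /absv_dist; have -> : x - z = (x - y) + (y - z) by rewrite addrA subrK.
exact: ler_absvD.
Qed.

HB.instance Definition _ := isMetric.Build R (normed_field_sort F)
  absv_distxx absv_dist_positivity absv_dist_sym absv_dist_triangle.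

End metric.

Definition complete_normed_field (R : realType) (F : normedFieldType R) : Prop :=
  forall s : nat -> F, cauchy (s @ \oo) -> cvg (s @ \oo).

Section power_series.
Context {R : realType} {F : normedFieldType R} {d : nat}.
Implicit Types (x u : 'rV[F]_d) (f : 'rV[F]_d -> F) (U : set 'rV[F]_d).

Definition multi_index := {ffun 'I_d -> nat}.

Definition mdegree (a : multi_index) : nat := \sum_i a i.

Definition mmonomial (a : multi_index) x : F := \prod_i x 0 i ^+ a i.

Definition max_absv x : R := \big[Num.max/0]_i absv (x 0 i).

Implicit Types c : multi_index -> F.

(* Unconditional convergence: over R or C this is absolute convergence, over
   a complete non-archimedean field it says that the terms tend to 0. *)
Definition pseries_sum c x (s : F) : Prop :=
  summability.partial_sum (fun a => c a * mmonomial a x)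
    @ summability.totally --> s.

Definition pseries_cvg c x : Prop := exists s, pseries_sum c x s.

Definition taylor_poly c (n : nat) x : F :=
  \sum_(a \in [set a | (mdegree a <= n)%N]) c a * mmonomial a x.

Definition taylor_series f u c : Prop :=
  forall n (e : R), 0 < e ->
    \forall x \near (0 : 'rV[F]_d),
      absv (f (u + x) - taylor_poly c n x) <= e * max_absv x ^+ n.

Definition smooth_on U f : Prop :=
  forall u, U u -> exists c, taylor_series f u c.

Definition analytic_at f u : Prop :=
  exists c, \forall y \near u, pseries_sum c (y - u) (f y).

Definition analytic_on U f : Prop := forall u, U u -> analytic_at f u.

End power_series.

Arguments multi_index : clear implicits.

(* A function on U is represented by a total function, two of which are
   identified when they agree on U (axiom [sections_ext]). *)
Record smoothSheaf (R : realType) (F : normedFieldType R) (d : nat) := {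
  sections :> set 'rV[F]_d -> set ('rV[F]_d -> F) ;
  sections_ext : forall U f g, open U ->
    {in U, f =1 g} -> sections U f -> sections U g ;
  sections_smooth : forall U f, open U -> sections U f -> smooth_on U f ;
  sections_restrict : forall U V f, open U -> open V -> V `<=` U ->
    sections U f -> sections V f ;
  sections_glue : forall (I : Type) (U : I -> set 'rV[F]_d)
      (f : I -> 'rV[F]_d -> F),
    (forall i, open (U i)) -> (forall i, sections (U i) (f i)) ->
    (forall i j, {in U i `&` U j, f i =1 f j}) ->
    exists2 g, sections (\bigcup_i U i) g & forall i, {in U i, g =1 f i}
}.

Section cantor.
Context {R : realType}.

Definition cantor_dist (a b : cantor_space) : R :=
  if pselect (exists n, a n != b n) is left neq_ab
  then 2^-1 ^+ ex_minn neq_ab else 0.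

Definition cylinder (s : seq bool) : set cantor_space :=
  [set a | forall i, (i < size s)%N -> a i = nth false s i].

Context {k : nat}.

Definition box (b : k.-tuple (seq bool)) : set ('I_k -> cantor_space) :=
  [set x | forall i, cylinder (tnth b i) (x i)].

Definition box_measure (b : k.-tuple (seq bool)) : R :=
  \prod_i 2^-1 ^+ size (tnth b i).

(* Outer measure of the product measure: the infimum of the total measure of
   the countable covers by boxes (there are countably many boxes). *)
Definition cantor_outer_measure (S : set ('I_k -> cantor_space)) : \bar R :=
  ereal_inf [set \esum_(b in B) (box_measure b)%:E
            | B in [set B | S `<=` \bigcup_(b in B) box b]].

End cantor.

Definition embedding (T T' : topologicalType) (iota : T -> T') : Prop :=
  [/\ injective iota, continuous iota &
      forall A, open A -> exists2 B, open B & A = iota @^-1` B].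

Section spread.
Context {R : realType} {F : normedFieldType R}.

Definition spread_embedding (iota : cantor_space -> F) : Prop :=
  embedding iota /\
  exists C gamma : R, [/\ 0 < C, 0 < gamma & forall x y,
    C * cantor_dist x y `^ gamma <= mdist (iota x) (iota y)].

Definition affine_spread (k : nat) (Y : set 'rV[F]_k) : Prop :=
  exists2 iota : 'I_k -> cantor_space -> F,
    forall i, spread_embedding (iota i) &
    (0 < @cantor_outer_measure R k
           ((fun x => \row_i iota i (x i)) @^-1` Y))%E.

Definition spread_set (k : nat) (X : set 'rV[F]_k.+1) : Prop :=
  affine_spread [set (\row_(i < k) (x 0 (lift ord0 i) / x 0 ord0))
                | x in [set x | X x /\ x 0 ord0 != 0]].

End spread.

Section gentric.
Context {R : realType} {F : normedFieldType R}.

Definition pre_gentric (d : nat) (S : smoothSheaf F d) : Prop :=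
  forall U u f c, open U -> U u -> S U f -> taylor_series f u c ->
    (forall y, U y -> pseries_cvg c (y - u)) ->
    forall y, U y -> pseries_sum c (y - u) (f y).

(* The dimension is k.+1, since spread sets are defined with the help of the
   first coordinate; functions of one variable live on F^1 = 'rV[F]_1. *)
Definition gentric (k : nat) (S : smoothSheaf F k.+1) : Prop :=
  pre_gentric S /\
  exists2 X : set 'rV[F]_k.+1, spread_set X &
    forall U u f x, open U -> U u -> S U f -> X x ->
      \forall z \near (0 : 'rV[F]_1),
        analytic_at (fun t : 'rV[F]_1 => f (u + t 0 0 *: x)) z.

End gentric.

(* Main.v *)
(* At a point u, let P_m be the degree-m part of the Taylor series of f. Along
   each direction x of the spread set, uniqueness of Taylor expansions turns
   analyticity into a geometric bound |P_m(x)| <= N_x^(m+1). By countable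
   subadditivity one N serves on a set of positive outer measure of directions.
   A polynomial of degree m bounded on such a set has its coefficients bounded by
   K^(m+1) times that bound (Lagrange interpolation at m+1 points spread along
   the Cantor tree, one variable at a time). Hence the Taylor coefficients grow
   geometrically, the series converges near u, and pre-genticity identifies its
   sum with f.

   The induction on the number of variables needs a Fubini argument, which fails
   for outer measures. Since the polynomials are uniformly continuous on the
   Cantor space, the set is first replaced by the dyadic cubes that it meets, and
   Fubini becomes counting. *)
Require Import Defs.
From mathcomp Require Import all_boot all_order all_algebra.
From mathcomp Require Import all_classical all_reals all_analysis.
From mathcomp Require Import finmap ring lra.
Set Implicit Arguments.
Unset Strict Implicit.
Unset Printing Implicit Defensive.
Import Order.TTheory GRing.Theory Num.Theory.
Local Open Scope classical_set_scope.
Local Open Scope ring_scope.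

(** * Absolute values and Lagrange interpolation *)

Section absolute_value.
Context {R : realType} {F : normedFieldType R}.
Implicit Types x y : F.

Lemma absv0 : absv (0 : F) = 0.
Proof. exact/absv_eq0P. Qed.

Lemma absv_eq0 x : (absv x == 0) = (x == 0).
Proof. by apply/eqP/eqP => /absv_eq0P. Qed.

Lemma absv_gt0 x : (0 < absv x) = (x != 0).
Proof. by rewrite lt_neqAle absv_ge0 andbT eq_sym absv_eq0. Qed.

Lemma absv1 : absv (1 : F) = 1.
Proof.
have n0 : absv (1 : F) != 0 by rewrite absv_eq0 oner_eq0.
by apply: (mulfI n0); rewrite -absvM !mulr1.
Qed.

Lemma absv_distC x y : absv (x - y) = absv (y - x).
Proof. exact: absv_dist_sym. Qed.

Lemma absvN x : absv (- x) = absv x.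
Proof. by rewrite -sub0r absv_distC subr0. Qed.

Lemma ler_absvB x y : absv (x - y) <= absv x + absv y.
Proof. by rewrite -[in leRHS](absvN y) ler_absvD. Qed.

Lemma absvX x n : absv (x ^+ n) = absv x ^+ n.
Proof. by elim: n => [|n IH]; rewrite ?expr0 ?absv1// !exprS absvM IH. Qed.

Lemma absvV x : absv (x^-1) = (absv x)^-1.
Proof.
have [->|x0] := eqVneq x 0; first by rewrite !(invr0, absv0).
have ax0 : absv x != 0 by rewrite absv_eq0.
by apply: (mulfI ax0); rewrite -absvM !divff// absv1.
Qed.

Lemma absv_prod (I : Type) (r : seq I) (P : pred I) (f : I -> F) :
  absv (\prod_(i <- r | P i) f i) = \prod_(i <- r | P i) absv (f i).
Proof.
by elim/big_rec2: _ => [|i a b _ <-]; rewrite ?absv1 ?absvM.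
Qed.

Lemma ler_absv_sum (I : Type) (r : seq I) (P : pred I) (f : I -> F) :
  absv (\sum_(i <- r | P i) f i) <= \sum_(i <- r | P i) absv (f i).
Proof.
elim/big_rec2: _ => [|i a b _ h]; first by rewrite absv0.
by apply: le_trans (ler_absvD _ _) _; rewrite lerD2l.
Qed.

End absolute_value.

(** The two sides agree at the [#|A|] distinct nodes, and their difference has size at most [#|A|],
    so it vanishes. *)
Lemma lagrange_interpolation (K : fieldType) (T : finType) (A : {set T})
    (y : T -> K) (p : {poly K}) :
  {in A &, injective y} -> (size p <= #|A|)%N ->
  p = \sum_(i in A) (p.[y i] / \prod_(j in A | j != i) (y i - y j)) *:
        \prod_(j in A | j != i) ('X - (y j)%:P).
Proof.
move=> y_inj sp; apply/eqP; rewrite -subr_eq0; apply/eqP.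
set q := \sum_(i in A) _.
have sq : (size q <= #|A|)%N.
  apply: leq_trans (size_sum _ _ _) _; apply/bigmax_leqP => i iA.
  apply: leq_trans (size_scale_leq _ _) _.
  rewrite -big_filter size_prod_XsubC size_filter -sum1_count.
  by rewrite -sum1_card [leqRHS](bigD1 i)//= add1n.
apply: (@roots_geq_poly_eq0 _ _ [seq y i | i <- enum A]).
- have hE i z : (\prod_(j in A | j != i) ('X - (y j)%:P)).[z] =
      \prod_(j in A | j != i) (z - y j).
    by rewrite horner_prod; apply: eq_bigr => j _; rewrite hornerXsubC.
  apply/allP => z /mapP[i]; rewrite mem_enum => iA ->.
  rewrite /root hornerD hornerN horner_sum (bigD1 i)//= hornerZ hE divfK; last first.
    apply/prodf_neq0 => j /andP[jA ji]; rewrite subr_eq0.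
    by apply: contraNneq ji => /y_inj -> //.
  rewrite big1 ?addr0 ?subrr// => j /andP[jA ji].
  by rewrite hornerZ hE [X in _ * X](bigD1 i) ?iA 1?eq_sym//= subrr mul0r mulr0.
- by rewrite map_inj_in_uniq ?enum_uniq// => i j; rewrite !mem_enum; exact: y_inj.
- by rewrite size_map -cardE (leq_trans (size_polyD _ _))// size_polyN geq_max sp sq.
Qed.

Section coefficient_bounds.
Context {R : realType} {F : normedFieldType R}.

(** Multiplying by ['X - (y i)%:P] adds to a shifted copy of the coefficients a copy scaled by at
    most [D], whence a factor [1 + D]. Indices rejected by [P] may be counted too, since
    [1 + D >= 1]. *)
Lemma coef_prod_XsubC_bound (I : Type) (r : seq I) (P : pred I) (y : I -> F)
    (D : R) (j : nat) :
  (forall i, P i -> absv (y i) <= D) -> 0 <= D ->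
  absv (\prod_(i <- r | P i) ('X - (y i)%:P))`_j <= (1 + D) ^+ size r.
Proof.
move=> yD D0; elim: r j => [|i r IH] j.
  rewrite big_nil coef1; case: eqP; rewrite ?absv0 ?absv1 ?expr0//.
rewrite big_cons exprS; case: ifP => Pi; last first.
  apply: le_trans (IH j) _; rewrite ler_peMl ?exprn_ge0//; lra.
rewrite mulrBl coefB mulrC coefMX coefCM.
apply: le_trans (ler_absvB _ _) _; rewrite mulrDl mul1r absvM.
apply: lerD; last by apply: ler_pM; rewrite ?absv_ge0 ?yD.
case: eqP => _; last exact: IH.
by rewrite absv0 exprn_ge0//; lra.
Qed.

(** Lagrange's formula is estimated term by term; [kappa] bounds the denominators from below. *)
Lemma interpolation_coef_bound (T : finType) (A : {set T}) (y : T -> F)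
    (p : {poly F}) (D kappa B : R) (j : nat) :
  (size p <= #|A|)%N -> {in A &, injective y} ->
  0 <= D -> (forall i, absv (y i) <= D) ->
  0 < kappa ->
  (forall i, i \in A -> kappa <= \prod_(j in A | j != i) absv (y i - y j)) ->
  0 <= B -> (forall i, i \in A -> absv p.[y i] <= B) ->
  absv p`_j <= #|A|%:R * (B / kappa * (1 + D) ^+ #|A|).
Proof.
move=> sp y_inj D0 yD k0 ky B0 pB.
rewrite {1}(lagrange_interpolation y_inj sp) coef_sum.
apply: le_trans (ler_absv_sum _ _ _) _.
rewrite -sum1_card natr_sum mulr_suml; apply: ler_sum => i iA.
rewrite mul1r coefZ absvM; apply: ler_pM; rewrite ?absv_ge0//.
  rewrite absvM absvV absv_prod; apply: ler_pM; rewrite ?invr_ge0 ?absv_ge0 ?pB//.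
    by apply: prodr_ge0 => l _; exact: absv_ge0.
  by rewrite lef_pV2 ?posrE ?ky// (lt_le_trans k0 (ky _ iA)).
rewrite -big_enum_cond/= sum1_card cardE; exact: coef_prod_XsubC_bound.
Qed.

End coefficient_bounds.

Definition ffun_cons (T : Type) (k : nat) (t : T) (a : {ffun 'I_k -> T}) :
    {ffun 'I_k.+1 -> T} :=
  [ffun i => oapp a t (unlift ord0 i)].

Lemma ffun_cons0 (T : Type) (k : nat) (t : T) (a : {ffun 'I_k -> T}) :
  ffun_cons t a ord0 = t.
Proof. by rewrite ffunE unlift_none. Qed.

Lemma ffun_consS (T : Type) (k : nat) (t : T) (a : {ffun 'I_k -> T}) i :
  ffun_cons t a (lift ord0 i) = a i.
Proof. by rewrite ffunE liftK. Qed.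

Lemma ffun_cons_eta (T : Type) (k : nat) (f : {ffun 'I_k.+1 -> T}) :
  ffun_cons (f ord0) [ffun i => f (lift ord0 i)] = f.
Proof.
apply/ffunP => i; case: (unliftP ord0 i) => [j ->|->]; rewrite ?ffun_cons0//.
by rewrite ffun_consS ffunE.
Qed.

Lemma big_ffun_cons (S : Type) (idx : S) (op : Monoid.com_law idx)
    (k : nat) (T : finType) (G : {ffun 'I_k.+1 -> T} -> S) :
  \big[op/idx]_f G f = \big[op/idx]_t \big[op/idx]_a G (ffun_cons t a).
Proof.
rewrite pair_big/=.
rewrite (reindex (fun p : T * {ffun 'I_k -> T} => ffun_cons p.1 p.2))//.
exists (fun f : {ffun 'I_k.+1 -> T} =>
  (f ord0, [ffun i : 'I_k => f (lift ord0 i)])) => [[t a] _|f _] /=.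
  rewrite ffun_cons0; congr pair; apply/ffunP => i; by rewrite ffunE ffun_consS.
exact: ffun_cons_eta.
Qed.

(** * Interpolation on grids *)

Section several_variables.
Context {R : realType} {F : normedFieldType R} (T : finType).

(* [y] samples [T] so well that any bound on a fraction [delta] of [T] transfers,
   up to the factor [K], to the coefficients of a polynomial of degree [m]. *)
Definition controls_coef (y : T -> F) (m : nat) (delta K : R) : Prop :=
  forall (A : {set T}) (p : {poly F}) (B : R),
    delta * #|T|%:R <= #|A|%:R -> (size p <= m.+1)%N -> 0 <= B ->
    (forall t, t \in A -> absv p.[y t] <= B) ->
    forall j, absv p`_j <= K * B.

(** A counting form of Fubini, by induction on [k]. The set [A] of first coordinates whose slice of
    [W] is still dense has proportion at least [delta]; the factor [2] per variable pays for the
    sparse slices. For [t] in [A] the induction hypothesis bounds the coefficients left after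
    substituting [y ord0 t], and these are values of one-variable polynomials. *)
Lemma controls_coef_multi (k m : nat) (y : 'I_k -> T -> F) (delta K : R)
    (W : {set {ffun 'I_k -> T}}) (C : {ffun 'I_k -> 'I_m.+1} -> F) (B : R) :
  0 < delta -> 0 <= K -> (0 < #|T|)%N ->
  (forall i, controls_coef (y i) m delta K) ->
  2 ^+ k * delta * #|T|%:R ^+ k <= #|W|%:R -> 0 <= B ->
  (forall w, w \in W ->
    absv (\sum_a C a * \prod_i y i (w i) ^+ a i) <= B) ->
  forall a, absv (C a) <= K ^+ k * B.
Proof.
move=> d0 K0 T0; have TR : 0 < #|T|%:R :> R by rewrite ltr0n.
elim: k y W C B => [|k IH] y W C B yc Wbig B0 WB a.
  have : (0 < #|W|)%N by rewrite -(ltr0n R) (lt_le_trans _ Wbig)// !expr0 mulr1 mul1r.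
  case/card_gt0P => w /WB; rewrite (bigD1 a)//= big_ord0 mulr1.
  rewrite big1 ?addr0 ?expr0 ?mul1r// => b.
  by case/eqP; apply/ffunP => -[].
pose Wt t := [set w | ffun_cons t w \in W]%SET.
pose A := [set t | 2 ^+ k * delta * #|T|%:R ^+ k <= #|Wt t|%:R]%SET.
have cardW : #|W|%:R = \sum_t #|Wt t|%:R :> R.
  rewrite -natr_sum; congr _%:R; rewrite -sum1_card big_mkcond/= big_ffun_cons.
  by apply: eq_bigr => t _; rewrite -sum1_card [RHS]big_mkcond/=;
    apply: eq_bigr => w _; rewrite inE.
have Abig : delta * #|T|%:R <= #|A|%:R.
  suff h : 2 ^+ k * (delta * #|T|%:R) <= #|A|%:R.
    apply: le_trans h; rewrite ler_peMl//; first by rewrite mulr_ge0// ltW.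
    by rewrite exprn_ege1// ler1n.
  have Tk : 0 < #|T|%:R ^+ k :> R by rewrite exprn_gt0.
  rewrite -(ler_pM2r Tk).
  (* A slice over [A] is at most the full fibre; any other slice lies below the threshold defining
     [A]. *)
  have : \sum_t #|Wt t|%:R <=
      \sum_t ((t \in A)%:R * #|T|%:R ^+ k + 2 ^+ k * delta * #|T|%:R ^+ k).
    apply: ler_sum => t _; case: (boolP (t \in A)) => tA.
      rewrite mul1r -[leLHS]addr0; apply: lerD; last by rewrite !mulr_ge0// ?exprn_ge0// ltW.
      rewrite -natrX ler_nat (leq_trans (max_card _))//.
      by rewrite card_ffun card_ord.
    by move: tA; rewrite inE -ltNge mul0r add0r => /ltW.
  rewrite -cardW => /(le_trans Wbig).
  rewrite big_split/= -mulr_suml sumr_const -natr_sum.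
  rewrite -[X in _ <= X%:R * _ + _]big_mkcond/= sum1_card.
  rewrite -[X in _ <= _ + X]mulr_natr !exprS.
  set t := #|T|%:R; set u := t ^+ k; set v := (X in 2 * X * delta); set w : R := #|A|%:R; rewrite -!/v; move: v w => v w; lra.
pose p := \poly_(j < m.+1) C (ffun_cons (inord j) [ffun i => a (lift ord0 i)]).
have -> : C a = p`_(a ord0).
  rewrite coef_poly ltn_ord inord_val; congr C; exact/esym/ffun_cons_eta.
rewrite exprS -mulrA; apply: (yc ord0 A) => //.
- exact: size_poly.
- by rewrite mulr_ge0// exprn_ge0.
move=> t tA; rewrite horner_poly.
pose C' (b : {ffun 'I_k -> 'I_m.+1}) :=
  \sum_(j < m.+1) C (ffun_cons j b) * y ord0 t ^+ j.
under eq_bigr do rewrite inord_val.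
apply: (IH (fun i => y (lift ord0 i)) (Wt t) C' B) => //.
- by move: tA; rewrite inE.
- move=> w; rewrite inE => /WB; congr (absv _ <= B).
  rewrite big_ffun_cons exchange_big/=; apply: eq_bigr => b _.
  rewrite mulr_suml; apply: eq_bigr => j _.
  rewrite big_ord_recl !ffun_cons0 -mulrA; congr (_ * (_ * _)).
  by apply: eq_bigr => i _; rewrite !ffun_consS.
Qed.

End several_variables.

(** * Words and the Cantor tree *)

Section tree_metric.
Context {R : realType} {F : normedFieldType R}.

(* [q ^+ rho] is the lower bound on distances; since the meeting depths seen from
   any point of the tree sum to at most [#|T|], the denominators in Lagrange's
   formula are at least [(C * q ^+ h) ^+ m.+1]. *)
Lemma controls_coef_tree (T : finType) (rho : T -> T -> nat) (y : T -> F)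
    (m h : nat) (delta D C q : R) :
  (forall t, (\sum_(s | s != t) rho t s <= #|T|)%N) ->
  0 <= D -> (forall t, absv (y t) <= D) ->
  0 < C -> C <= 1 -> 0 < q -> q <= 1 ->
  (forall t s, s != t -> C * q ^+ rho t s <= absv (y t - y s)) ->
  m.+1%:R <= delta * #|T|%:R -> (#|T| <= h * m.+1)%N ->
  controls_coef y m delta ((2 * (1 + D) / (C * q ^+ h)) ^+ m.+1).
Proof.
move=> sum_rho D0 yD C0 C1 q0 q1 yrho mT Th A p B Abig sp B0 pB j.
have mA : (m.+1 <= #|A|)%N by rewrite -(ler_nat R) (le_trans mT).
(* Keeping exactly [m.+1] nodes makes the exponents in the estimate depend on [m] only. *)
have [A' A'A A'm] : exists2 A' : {set T}, A' \subset A & #|A'| = m.+1.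
  exists [set t in take m.+1 (enum A)]%SET.
    by apply/fintype.subsetP => t; rewrite inE => /mem_take; rewrite mem_enum.
  rewrite cardsE; have /card_uniqP -> := take_uniq m.+1 (enum_uniq A).
  by rewrite size_takel// -cardE.
have Cq : 0 < C * q ^+ h by rewrite mulr_gt0// exprn_gt0.
have := @interpolation_coef_bound R F T A' y p D ((C * q ^+ h) ^+ m.+1) B j.
rewrite A'm => /(_ sp) H; apply: le_trans (H _ D0 yD _ _ B0 _) _.
- move=> t s tA sA yts; apply/eqP; apply: contraT => nts.
  have := yrho s t nts; rewrite yts subrr absv0 leNgt mulr_gt0// exprn_gt0//.
- by rewrite exprn_gt0.
- move=> t tA.
  (* The product separates into a power of [C] and a power of [q]. As both are at most [1], the
     exponents may be enlarged to [m.+1] and [h * m.+1]. *)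
  apply: (@le_trans _ _ (\prod_(s in A' | s != t) (C * q ^+ rho t s))); last first.
    apply: ler_prod => s /andP[_ st]; rewrite yrho// andbT.
    exact: mulr_ge0 (ltW C0) (exprn_ge0 _ (ltW q0)).
  rewrite big_split/= exprMn.
  apply: ler_pM; rewrite ?exprn_ge0 ?(ltW C0) ?(ltW q0)//.
  + rewrite prodr_const -A'm; apply: (ler_wiXn2l (ltW C0) C1).
    by apply: subset_leq_card; apply/fintype.subsetP => s /andP[].
  + rewrite prodrXr -exprM; apply: (ler_wiXn2l (ltW q0) q1).
    apply: leq_trans Th; apply: leq_trans (sum_rho t).
    by rewrite big_mkcondl/=; apply: leq_sum => s _; case: ifP.
- by move=> t tA; apply: pB; exact: (fintype.subsetP A'A).
(* The number [m.+1] of interpolation terms is absorbed by [2 ^+ m.+1]. *)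
rewrite [leRHS](_ : _ = 2 ^+ m.+1 * (B / (C * q ^+ h) ^+ m.+1 * (1 + D) ^+ m.+1)).
  rewrite ler_wpM2r ?mulr_ge0 ?invr_ge0 ?exprn_ge0 ?(ltW Cq) ?addr_ge0//.
  by rewrite -natrX ler_nat ltnW// ltn_expl.
by rewrite exprMn exprVn exprMn; ring.
Qed.

End tree_metric.

(** The length of the longest common prefix, that is, the depth at which two branches of the tree
    separate. *)
Fixpoint lcp (s t : seq bool) : nat :=
  if s is a :: s' then
    if t is b :: t' then if a == b then (lcp s' t').+1 else 0%N else 0%N
  else 0%N.

Lemma nth_lcp_neq (s t : seq bool) : size s = size t -> s != t ->
  (lcp s t < size s)%N /\ nth false s (lcp s t) != nth false t (lcp s t).
Proof.
elim: s t => [|a s IH] [|b t]//= [st]; rewrite eqseq_cons.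
case: eqP => [_|/eqP ab] //= nst.
by have [] := IH _ st nst.
Qed.

Lemma big_tuple_cons (S : Type) (idx : S) (op : Monoid.com_law idx)
    (n : nat) (T : finType) (G : n.+1.-tuple T -> S) :
  \big[op/idx]_w G w = \big[op/idx]_t \big[op/idx]_(w : n.-tuple T) G [tuple of t :: w].
Proof.
rewrite pair_big/=.
rewrite (reindex (fun p : T * n.-tuple T => [tuple of p.1 :: p.2]))//.
exists (fun w : n.+1.-tuple T => (thead w, [tuple of behead w])) => [[t w] _|w _] /=.
  by rewrite theadE; congr pair; exact/val_inj.
by rewrite -tuple_eta.
Qed.

(** Words with another first letter contribute [0]. The [2 ^ n] words with the same one contribute
    at most one more each than their tails do, so the bound doubles with [n]. Being linear in the
    number of words, it keeps the growth in the degree geometric. *)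
Lemma sum_lcp (n : nat) (t : n.-tuple bool) :
  (\sum_(s | s != t) lcp t s <= 2 ^ n)%N.
Proof.
elim: n t => [|n IH] t; first by rewrite big1// => s; rewrite (tuple0 s) (tuple0 t) eqxx.
rewrite big_mkcond big_tuple_cons/= (tuple_eta t).
set a := thead t; set t' := [tuple of behead t].
rewrite (bigD1 a)//= [X in (_ + X)%N]big1 ?addn0; last first.
  move=> b ba; apply: big1 => s _ /=.
  by rewrite [a == b]eq_sym (negbTE ba); case: ifP.
apply: (@leq_trans (\sum_(s : n.-tuple bool) ((if s != t' then lcp t' s else 0) + 1))).
  apply: leq_sum => s _; rewrite eqxx -!val_eqE/= eqseq_cons eqxx/=.
  by case: ifP => //; rewrite addn1.
rewrite big_split/= sum1_card card_tuple card_bool -big_mkcond/=.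
by rewrite expnS mul2n -addnn leq_add2r IH.
Qed.

Section cantor_words.
Context {R : realType}.

Definition word_point (s : seq bool) : cantor_space := fun i => nth false s i.

Lemma cantor_dist_ge (x y : cantor_space) (n : nat) :
  x n != y n -> 2^-1 ^+ n <= cantor_dist x y :> R.
Proof.
move=> xy; rewrite /cantor_dist; case: pselect => [e|]; last by case; exists n.
case: ex_minnP => l _ /(_ n xy) ln.
by apply: ler_wiXn2l => //; rewrite ?invr_ge0// invf_le1// ler1n.
Qed.

End cantor_words.

(** * Uniform continuity and outer measure on powers of the Cantor space *)

(** Compactness of the sequences over a finite alphabet, by König's argument. A word is [bad] if its
    extensions escape [P] at every length; a bad word has a bad successor, and following these
    yields a sequence with no prefix in [P]. *)
Lemma fan_theorem (A : finType) (P : seq A -> Prop) :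
  (forall s a, P s -> P (rcons s a)) ->
  (forall x : nat -> A, exists n, P (mkseq x n)) ->
  exists n, forall s, size s = n -> P s.
Proof.
move=> Prcons Pbar.
have Pcat s t : P s -> P (s ++ t).
  elim/last_ind: t => [|t a IH] Ps; first by rewrite cats0.
  by rewrite -rcons_cat; apply: Prcons; exact: IH.
apply: contrapT => nP.
pose bad s := forall n, exists2 t, size t = n & ~ P (s ++ t).
have bad0 : bad [::].
  move=> n; apply: contrapT => nt; apply: nP; exists n => s sn.
  by apply: contrapT => nPs; apply: nt; exists s.
(* [a0] is the default value of the choice function at words that are not bad. *)
have [a0 _] : exists a0 : A, True.
  by have [[|a t]//= _ _] := bad0 1%N; exists a.
have bad_step s : exists a, bad s -> bad (rcons s a).
  have [bs|nbs] := pselect (bad s); last by exists a0 => /nbs.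
  apply: contrapT => na.
  have /(_ _)/cid nPa a : exists n, forall t, size t = n -> P (rcons s a ++ t).
    apply: contrapT => nn; apply: na; exists a => _ n.
    apply: contrapT => nt; apply: nn; exists n => t tn.
    by apply: contrapT => nPt; apply: nt; exists t.
  pose N a := projT1 (nPa a).
  (* If no successor is bad, the largest of their finitely many bounds works for [s], with one more
     letter for the successor itself. *)
  have [[|a t]//= [tN] nPt] := bs (\max_a N a).+1.
  apply: nPt; rewrite -cat_rcons -(cat_take_drop (N a) t) catA; apply: Pcat.
  apply: (projT2 (nPa a)); rewrite size_takel// tN.
  exact: (leq_bigmax a).
have [f fP] := choice bad_step.
pose g n := iter n (fun s => rcons s (f s)) [::].
pose x n := f (g n).
have gE n : mkseq x n = g n by elim: n => //= n IH; rewrite mkseqS IH.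
have bad_g n : bad (g n) by elim: n => //= n; exact: fP.
have [n] := Pbar x; rewrite gE.
by have [t /size0nil ->] := bad_g n 0%N; rewrite cats0.
Qed.

Section cantor_continuity.
Context {R : realType} {F : normedFieldType R} {k : nat}.
Implicit Types (h : ('I_k -> cantor_space) -> F) (x y z : 'I_k -> cantor_space).

Definition agree (n : nat) x y : Prop := forall i j, (j < n)%N -> x i j = y i j.

Lemma agree_le n m x y : (n <= m)%N -> agree m x y -> agree n x y.
Proof. by move=> nm xy i j /leq_trans/(_ nm)/xy. Qed.

(** Continuity for the product topology, in which the points agreeing with [x] to depth [n] form a
    neighbourhood basis of [x]. *)
Definition cantor_cts h : Prop := forall x (e : R), 0 < e ->
  exists n, forall y, agree n x y -> absv (h y - h x) < e.

Lemma cantor_cts_cst c : cantor_cts (fun=> c).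
Proof. by move=> x e e0; exists 0%N => y _; rewrite subrr absv0. Qed.

Lemma cantor_ctsD h1 h2 : cantor_cts h1 -> cantor_cts h2 ->
  cantor_cts (fun x => h1 x + h2 x).
Proof.
move=> c1 c2 x e e0; have e20 : 0 < e / 2 by rewrite divr_gt0.
have [n1 n1P] := c1 x _ e20; have [n2 n2P] := c2 x _ e20.
exists (maxn n1 n2) => y xy.
have {}n1P := n1P y (agree_le (leq_maxl _ _) xy).
have {}n2P := n2P y (agree_le (leq_maxr _ _) xy).
rewrite opprD addrACA [e]splitr.
exact: le_lt_trans (ler_absvD _ _) (ltrD n1P n2P).
Qed.

Lemma cantor_ctsM h1 h2 : cantor_cts h1 -> cantor_cts h2 ->
  cantor_cts (fun x => h1 x * h2 x).
Proof.
move=> c1 c2 x e e0.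
set a := absv (h1 x); set b := absv (h2 x).
have a0 : 0 <= a by exact: absv_ge0.
have b0 : 0 <= b by exact: absv_ge0.
(* Since [d <= 1], the three terms of the expansion below sum to less than [d * (a + b + 1)], which
   is at most [e]. *)
pose d := Num.min 1 (e / (a + b + 1)).
have d0 : 0 < d by rewrite lt_min ltr01 divr_gt0//; lra.
have [n1 n1P] := c1 x _ d0; have [n2 n2P] := c2 x _ d0.
exists (maxn n1 n2) => y xy.
have {}n1P := n1P y (agree_le (leq_maxl _ _) xy).
have {}n2P := n2P y (agree_le (leq_maxr _ _) xy).
have -> : h1 y * h2 y - h1 x * h2 x = (h1 y - h1 x) * (h2 y - h2 x)
    + (h1 y - h1 x) * h2 x + h1 x * (h2 y - h2 x) by ring.
apply: le_lt_trans (ler_absvD _ _) _.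
apply: le_lt_trans (lerD (ler_absvD _ _) (lexx _)) _; rewrite !absvM.
move: n1P n2P; rewrite -/a -/b.
have := absv_ge0 (h1 y - h1 x); have := absv_ge0 (h2 y - h2 x).
move: (absv (h1 y - h1 x)) (absv (h2 y - h2 x)) => u v v0 u0 ud vd.
have d1 : d <= 1 by rewrite ge_min lexx.
have : d * (a + b + 1) <= e by rewrite -ler_pdivlMr ?ge_min ?lexx ?orbT//; lra.
nra.
Qed.

Lemma cantor_cts_sum (I : Type) (r : seq I) (P : pred I) (h : I -> _) :
  (forall i, cantor_cts (h i)) -> cantor_cts (fun x => \sum_(i <- r | P i) h i x).
Proof.
move=> hc; elim: r => [|i r IH].
  by under eq_fun do rewrite big_nil; exact: cantor_cts_cst.
under eq_fun do rewrite big_cons.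
by case: (P i) => //; exact: cantor_ctsD.
Qed.

Lemma cantor_cts_prod (I : Type) (r : seq I) (P : pred I) (h : I -> _) :
  (forall i, cantor_cts (h i)) -> cantor_cts (fun x => \prod_(i <- r | P i) h i x).
Proof.
move=> hc; elim: r => [|i r IH].
  by under eq_fun do rewrite big_nil; exact: cantor_cts_cst.
under eq_fun do rewrite big_cons.
by case: (P i) => //; exact: cantor_ctsM.
Qed.

Lemma cantor_ctsX h n : cantor_cts h -> cantor_cts (fun x => h x ^+ n).
Proof.
move=> hc; elim: n => [|n IH].
  by under eq_fun do rewrite expr0; exact: cantor_cts_cst.
by under eq_fun do rewrite exprS; exact: cantor_ctsM.
Qed.

(** Otherwise some points [y n], agreeing with [x] to depth [n], have images far from that of [x];
    but their coordinates [i] converge to [x i]. *)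
Lemma cantor_cts_comp (iota : cantor_space -> F) i :
  continuous iota -> cantor_cts (fun x => iota (x i)).
Proof.
move=> ic x e e0; apply: contrapT => nP.
have /choice[y yP] : forall n, exists y, agree n x y /\ e <= absv (iota (y i) - iota (x i)).
  move=> n; apply: contrapT => nn; apply: nP; exists n => y xy.
  by rewrite ltNge; apply/negP => h; apply: nn; exists y.
pose g n : cantor_space := y n i.
have gcvg : g @ \oo --> (x i : cantor_space).
  (* A neighbourhood given by coordinate [N] contains every term of index greater than [N]. *)
  apply/cvg_sup => N V [W] [[Z] oZ <-] ZN ZV.
  apply: (filterS ZV); rewrite nbhs_simpl /g; exists N.+1 => // l /= Nl.
  by have [xy _] := yP l; rewrite -(xy i N).
have : nbhs (x i) (iota @^-1` ball (iota (x i)) e).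
  by apply: ic; exact: nbhsx_ballx.
move=> /gcvg; rewrite nbhs_simpl => -[N _ /(_ N (leqnn N))] /=.
rewrite /ball/= /absv_dist absv_distC ltNge => /negP; apply.
by have [] := yP N.
Qed.

(** Heine's theorem, by [fan_theorem] over an alphabet whose letters collect the bits of all [k]
    branches at one depth. *)
Lemma cantor_cts_uniform h (e : R) : cantor_cts h -> 0 < e ->
  exists n, forall x y, agree n x y -> absv (h x - h y) < e.
Proof.
move=> hc e0.
pose A := {ffun 'I_k -> bool}.
pose extends (s : seq A) x :=
  forall i j, (j < size s)%N -> x i j = nth [ffun=> false] s j i.
pose P (s : seq A) := forall x y, extends s x -> extends s y -> absv (h x - h y) < e.
have [] := @fan_theorem A P.
- move=> s a Ps x y xs ys; apply: Ps.
    by move=> i j js; rewrite xs ?size_rcons ?ltnS 1?ltnW// nth_rcons js.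
  by move=> i j js; rewrite ys ?size_rcons ?ltnS 1?ltnW// nth_rcons js.
- move=> w; pose x i : cantor_space := fun j => w j i.
  have [n nP] : exists n, forall y, agree n x y -> absv (h y - h x) < e / 2.
    by apply: hc; rewrite divr_gt0.
  exists n => y z; rewrite /extends size_mkseq => yE zE.
  have xy : agree n x y by move=> i j jn; rewrite yE// nth_mkseq.
  have xz : agree n x z by move=> i j jn; rewrite zE// nth_mkseq.
  have -> : h y - h z = (h y - h x) + (h x - h z) by rewrite addrA subrK.
  rewrite [e]splitr; apply: le_lt_trans (ler_absvD _ _) _.
  by apply: ltrD; [exact: nP|rewrite absv_distC; exact: nP].
move=> n nP; exists n => x y xy.
apply: (nP (mkseq (fun j => [ffun i => x i j]) n)); rewrite ?size_mkseq//.
  by move=> i j; rewrite size_mkseq => jn; rewrite nth_mkseq// ffunE.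
by move=> i j; rewrite size_mkseq => jn; rewrite nth_mkseq// ffunE xy.
Qed.

(** By uniform continuity every value is within [1] of the value at one of finitely many points, the
    words of length [n] continued by [false]. *)
Lemma cantor_cts_bounded h : cantor_cts h -> exists2 D, 0 <= D & forall x, absv (h x) <= D.
Proof.
move=> hc; have [n nP] := cantor_cts_uniform hc ltr01.
pose z (w : {ffun 'I_k -> n.-tuple bool}) i := word_point (w i).
exists (\sum_w absv (h (z w)) + 1).
  by rewrite addr_ge0// sumr_ge0// => w _; exact: absv_ge0.
move=> x; pose w := [ffun i : 'I_k => [tuple x i j | j < n]].
have xw : agree n x (z w).
  move=> i j jn; rewrite /z /word_point ffunE.
  by rewrite (_ : j = Ordinal jn :> nat)// -tnth_nth tnth_mktuple.
rewrite -(subrK (h (z w)) (h x)) addrC; apply: le_trans (ler_absvD _ _) _.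
apply: lerD; last by rewrite ltW// nP.
by rewrite (bigD1 w)//= lerDl sumr_ge0// => w' _; exact: absv_ge0.
Qed.

End cantor_continuity.

Section outer_measure.
Context {R : realType} {k : nat}.
Implicit Types S Z : set ('I_k -> cantor_space).

Lemma box_measure_ge0 (b : k.-tuple (seq bool)) : 0 <= box_measure b :> R.
Proof. by apply: prodr_ge0 => i _; rewrite exprn_ge0// invr_ge0. Qed.

(** Countable subadditivity for null sets: the [n]-th set gets a cover of total measure at most
    [e / 2 ^ n.+1]. *)
Lemma cantor_outer_measure_bigcup0 S (Z : nat -> set ('I_k -> cantor_space)) :
  S `<=` \bigcup_n Z n ->
  (forall n, (@cantor_outer_measure R k (Z n) <= 0)%E) ->
  (@cantor_outer_measure R k S <= 0)%E.
Proof.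
move=> SZ Z0; apply/lee_addgt0Pr => e e0; rewrite add0e.
have /choice[B BP] : forall n, exists B : set (k.-tuple (seq bool)),
    Z n `<=` \bigcup_(b in B) box b /\
    (\esum_(b in B) (box_measure b)%:E <= (e / (2 ^ n.+1)%:R)%:E :> \bar R)%E.
  move=> n; have : (@cantor_outer_measure R k (Z n) < (e / (2 ^ n.+1)%:R)%:E)%E.
    by apply: le_lt_trans (Z0 n) _; rewrite lte_fin divr_gt0// ltr0n expn_gt0.
  by case/ereal_inf_lt => _ [B ZB <-] /ltW Be; exists B.
(* Boxes occurring at an earlier index are dropped, so that the sum over the union splits as a
   series. *)
pose B' := seqDU B.
have bB' : \bigcup_n B' n = \bigcup_n B n by rewrite -seqDU_bigcup_eq.
apply: (@le_trans _ _ (\esum_(b in \bigcup_n B' n) (box_measure b)%:E)%E).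
  apply: ereal_inf_lbound; exists (\bigcup_n B' n) => //=.
  move=> x /SZ[n _ /(proj1 (BP n))[b Bb bx]].
  by exists b => //; rewrite bB'; exists n.
rewrite nneseries_sum_bigcup//; last by move=> b; rewrite lee_fin box_measure_ge0.
  apply: le_trans (epsilon_trick0 xpredT (ltW e0)).
  apply: lee_nneseries => [n _ _|n _].
    by apply: esum_ge0 => b _; rewrite lee_fin box_measure_ge0.
  apply: le_trans (proj2 (BP n)).
  apply: le_ereal_sup => _ [X [finX XB'] <-]; exists X => //; split=> //.
  by apply: subset_trans XB' _ => b [].
exact: trivIset_seqDU.
Qed.

(* Averaging over the suffixes [s] of length [l] brings a grid of depth [n + l],
   fine enough for uniform continuity, back to one of depth [n], whose size is
   proportional to the degree of the polynomial to be interpolated. *)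
Lemma cantor_outer_measure_grid Z (n l : nat) (delta : R) :
  (delta%:E <= @cantor_outer_measure R k Z)%E ->
  exists s : {ffun 'I_k -> l.-tuple bool},
    delta * (2 ^+ n) ^+ k <=
      #|[set b : {ffun 'I_k -> n.-tuple bool} |
          `[< exists2 x, Z x & forall i, cylinder (b i ++ s i) (x i) >]]%SET|%:R.
Proof.
move=> Zd.
pose T := {ffun 'I_k -> n.-tuple bool}; pose L := {ffun 'I_k -> l.-tuple bool}.
pose meets (p : T * L) :=
  `[< exists2 x, Z x & forall i, cylinder (p.1 i ++ p.2 i) (x i) >].
pose word (p : T * L) : k.-tuple (seq bool) :=
  [tuple (tval (p.1 i) ++ tval (p.2 i)) | i < k].
have word_inj : injective word.
  move=> [b s] [b' s'] /(congr1 (fun t => tnth t)) E.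
  have {}E i : b i = b' i /\ s i = s' i.
    have := congr1 (fun f => f i) E; rewrite !tnth_mktuple/= => /eqP.
    by rewrite eqseq_cat ?size_tuple// => /andP[/eqP/val_inj -> /eqP/val_inj ->].
  by congr pair; apply/ffunP => i; case: (E i).
pose G := [set p | meets p]%SET.
(* The boxes of depth [n + l] that meet [Z] cover it, so their number is at least [delta] times the
   number of all such boxes. *)
have cover : Z `<=` \bigcup_(b in word @` [set` G]) box b.
  move=> x Zx; pose b : T := [ffun i => [tuple x i j | j < n]].
  pose s : L := [ffun i => [tuple x i (n + j)%N | j < l]].
  have bs i : cylinder (b i ++ s i) (x i).
    move=> j; rewrite size_cat !size_tuple nth_cat size_tuple !ffunE => jnl.
    case: ltnP => jn.
      by rewrite (_ : j = Ordinal jn :> nat)// -tnth_nth tnth_mktuple.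
    have jl : (j - n < l)%N by rewrite ltn_subLR.
    by rewrite (_ : (j - n)%N = Ordinal jl :> nat)// -tnth_nth tnth_mktuple/= subnKC.
  exists (word (b, s)); first by exists (b, s) => //=; rewrite inE; apply/asboolP; exists x.
  by move=> i; rewrite tnth_mktuple.
have : (delta%:E <= (#|G|%:R * (2^-1 ^+ (n + l)) ^+ k)%:E)%E.
  apply: le_trans Zd _; apply: le_trans (ereal_inf_lbound _) _.
    by exists (word @` [set` G]).
  rewrite esum_fset; last 2 first.
  - by apply: finite_image; exact: finite_finset.
  - by move=> b _; rewrite lee_fin box_measure_ge0.
  rewrite fsbig_image; last by move=> p q _ _; exact: word_inj.
  rewrite (eq_fsbigr (fun=> (((2^-1 ^+ (n + l)) ^+ k : R))%:E)); last first.
    move=> p _; rewrite /box_measure; congr EFin.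
    rewrite (eq_bigr (fun=> 2^-1 ^+ (n + l))) ?prodr_const ?card_ord// => i _.
    by rewrite tnth_mktuple size_cat !size_tuple.
  rewrite (fsbig_fwiden (enum G)) ?enum_uniq//; last 2 first.
  - by move=> p /=; rewrite mem_enum.
  - by move=> p [/=]; rewrite mem_enum.
  by rewrite sumEFin big_enum/= sumr_const mulr_natl.
rewrite lee_fin => dG.
(* If every suffix fell short of the bound, summing over all suffixes would contradict the count
   [dG]. *)
apply: contrapT => ns.
have Gs s : #|[set b : T | meets (b, s)]%SET|%:R < delta * (2 ^+ n) ^+ k.
  by rewrite ltNge; apply/negP => h; apply: ns; exists s.
have cG : #|G|%:R = \sum_s #|[set b : T | meets (b, s)]%SET|%:R :> R.
  rewrite -natr_sum; congr _%:R; rewrite -sum1_card big_mkcond/=.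
  pose g b s := if meets (b, s) then 1%N else 0%N.
  rewrite (eq_bigr (fun p => g p.1 p.2)) => [|[b s] _]; last by rewrite inE.
  rewrite -(pair_bigA _ g)/= exchange_big/=; apply: eq_bigr => s _.
  by rewrite -sum1_card [RHS]big_mkcond/=; apply: eq_bigr => b _; rewrite !inE.
have : #|G|%:R < \sum_(s : L) delta * (2 ^+ n) ^+ k.
  rewrite cG; apply: ltr_sum => //; apply/hasP.
  by exists [ffun=> [tuple of nseq l false]]; rewrite ?mem_index_enum.
rewrite sumr_const card_ffun card_tuple card_bool card_ord -[ltRHS]mulr_natr !natrX.
move: dG; rewrite exprVn exprVn ler_pdivlMr ?exprn_gt0// => dG.
by rewrite ltNge -mulrA -exprMn -exprD dG.
Qed.

End outer_measure.

(** * Coefficient bounds from spread embeddings *)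

Section spread_interpolation.
Context {R : realType} {F : normedFieldType R}.

(** Take the least power of two exceeding [H * m.+1], where [H] is an integer above [delta^-1];
    minimality bounds it by twice that product. *)
Lemma exists_level (delta : R) : 0 < delta -> exists h : nat, forall m : nat,
  exists n : nat, m.+1%:R <= delta * 2 ^+ n /\ (2 ^ n <= h * m.+1)%N.
Proof.
move=> d0; pose H := (Num.truncn delta^-1).+1.
have HP : 1 <= delta * H%:R.
  by rewrite mulrC -ler_pdivrMr// mul1r ltW// truncnS_gt.
exists (2 * H)%N => m.
pose N := (H * m.+1)%N; have N0 : (0 < N)%N by [].
exists (trunc_log 2 N).+1; split; last first.
  by rewrite expnS -mulnA leq_mul2l/=; exact: trunc_logP.
rewrite -natrX.
apply: (@le_trans _ _ (delta * N%:R)).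
  by rewrite natrM mulrA ler_peMl.
by rewrite ler_pM2l// ler_nat ltnW// trunc_log_ltn.
Qed.

(** The constant [K] is uniform in the degree, in the level and in the suffix [s]: a common suffix
    leaves the meeting depths of distinct words unchanged. *)
Lemma words_control (iota : cantor_space -> F) (h : nat) :
  spread_embedding iota -> exists2 K : R, 0 <= K &
  forall (m n l : nat) (s : l.-tuple bool) (delta : R),
    m.+1%:R <= delta * 2 ^+ n -> (2 ^ n <= h * m.+1)%N ->
    controls_coef (fun w : n.-tuple bool => iota (word_point (w ++ s)))
      m delta (K ^+ m.+1).
Proof.
move=> [[_ iota_cts _] [C0 [gamma [C00 g0 iotaP]]]].
have [D D0 iotaD] := cantor_cts_bounded (cantor_cts_comp (ord0 : 'I_1) iota_cts).
pose C := Num.min 1 C0; pose q : R := 2^-1 `^ gamma.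
have C_gt0 : 0 < C by rewrite lt_min ltr01.
have q0 : 0 < q by rewrite powR_gt0// invr_gt0.
have q1 : q <= 1.
  rewrite /q [leRHS](_ : _ = 1 `^ gamma); last by rewrite powR1.
  apply: ge0_ler_powR; rewrite ?nnegrE ?invr_ge0 ?(ltW g0)//.
  by rewrite invf_le1 ?ler1n.
have qX n : (2^-1 ^+ n) `^ gamma = q ^+ n.
  by rewrite -[2^-1 ^+ n]powR_mulrn ?invr_ge0// -powRrM mulrC powRrM powR_mulrn// ltW.
exists (2 * (1 + D) / (C * q ^+ h)).
  by rewrite divr_ge0 ?mulr_ge0 ?addr_ge0 ?exprn_ge0 ?(ltW C_gt0) ?(ltW q0).
move=> m n l s delta mn nh.
apply: (controls_coef_tree (rho := fun w v : n.-tuple bool => lcp w v)) => //.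
- by move=> w; rewrite card_tuple card_bool; exact: sum_lcp.
- by move=> w; exact: (iotaD (fun=> word_point (w ++ s))).
- by rewrite ge_min lexx.
- move=> w v vw; have wv : tval w != tval v by rewrite eq_sym.
  have [lt_lcp neq_lcp] := nth_lcp_neq (etrans (size_tuple w) (esym (size_tuple v))) wv.
  rewrite -qX; apply: le_trans (iotaP _ _).
  apply: ler_pM; rewrite ?powR_ge0 ?(ltW C_gt0)//; first by rewrite ge_min lexx orbT.
  apply: ge0_ler_powR; rewrite ?nnegrE ?exprn_ge0 ?invr_ge0 ?(ltW g0)//.
    by rewrite /cantor_dist; case: pselect => // e; rewrite exprn_ge0// invr_ge0.
  apply: cantor_dist_ge; rewrite /word_point !nth_cat.
  by rewrite size_tuple in lt_lcp; rewrite !size_tuple lt_lcp.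
- by rewrite card_tuple card_bool natrX.
- by rewrite card_tuple card_bool.
Qed.

(** [K] is chosen before the degree and the polynomial. The [1] added to [B] pays for moving from a
    point of [Z] to a word of the grid in the same box. *)
Lemma spread_coef_bound (k : nat) (iota : 'I_k -> cantor_space -> F)
    (Z : set ('I_k -> cantor_space)) (delta : R) :
  (forall i, spread_embedding (iota i)) -> 0 < delta ->
  (delta%:E <= @cantor_outer_measure R k Z)%E ->
  exists2 K : R, 0 <= K &
  forall (m : nat) (C : {ffun 'I_k -> 'I_m.+1} -> F) (B : R), 0 <= B ->
    (forall x, Z x -> absv (\sum_a C a * \prod_i iota i (x i) ^+ a i) <= B) ->
    forall a, absv (C a) <= (K ^+ m.+1) ^+ k * (B + 1).
Proof.
move=> iota_spread d0 Zd.
(* This compensates for the factor [2 ^+ k] lost in [controls_coef_multi]. *)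
pose delta' := delta / 2 ^+ k.
have d'0 : 0 < delta' by rewrite divr_gt0 ?exprn_gt0.
have [h hP] := exists_level d'0.
have /choice[K KP] : forall i, exists K : R, 0 <= K /\
    forall (m n l : nat) (s : l.-tuple bool) (e : R),
      m.+1%:R <= e * 2 ^+ n -> (2 ^ n <= h * m.+1)%N ->
      controls_coef (fun w : n.-tuple bool => iota i (word_point (w ++ s)))
        m e (K ^+ m.+1).
  by move=> i; have [K K0 KP] := words_control h (iota_spread i); exists K.
have K0 i : 0 <= K i by case: (KP i).
exists (\sum_i K i); first exact: sumr_ge0.
move=> m C B B0 ZB a.
have [n [mn nh]] := hP m.
pose g (x : 'I_k -> cantor_space) := \sum_a C a * \prod_i iota i (x i) ^+ a i.
have g_cts : cantor_cts g.
  apply: cantor_cts_sum => b; apply: cantor_ctsM; first exact: cantor_cts_cst.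
  apply: cantor_cts_prod => i; apply: cantor_ctsX; apply: cantor_cts_comp.
  by have [[]] := iota_spread i.
(* The depth [l] depends on the polynomial, which is harmless because the constants [K i] hold for
   all suffix lengths. *)
have [l lP] := cantor_cts_uniform g_cts ltr01.
have [s sP] := cantor_outer_measure_grid n l Zd.
set W := [set b | _]%SET in sP.
pose y i (w : n.-tuple bool) := iota i (word_point (w ++ s i)).
have := @controls_coef_multi R F (n.-tuple bool) k m y delta'
  ((\sum_i K i) ^+ m.+1) W C (B + 1).
rewrite card_tuple card_bool natrX; apply => //.
- by rewrite exprn_ge0// sumr_ge0.
- by rewrite expn_gt0.
- move=> i A p B' Abig sp B'0 pB' j.
  have [_ /(_ m n l (s i) delta' mn nh)] := KP i.
  move=> /(_ A p B' Abig sp B'0 pB' j) /le_trans; apply.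
  rewrite ler_wpM2r// lerXn2r ?nnegrE ?sumr_ge0//.
  by rewrite (bigD1 i)//= lerDl sumr_ge0.
- by rewrite /delta' [2 ^+ k * _]mulrC divfK ?expf_neq0.
- by rewrite addr_ge0.
move=> w; rewrite inE => /asboolP[x Zx wx].
pose z i := word_point (w i ++ s i).
have xz : agree l x z.
  move=> i j jl; rewrite wx// size_cat !size_tuple.
  by rewrite (leq_trans jl)// leq_addl.
have -> : \sum_b C b * \prod_i y i (w i) ^+ b i = g z by [].
rewrite -(subrK (g x) (g z)) addrC; apply: le_trans (ler_absvD _ _) _.
by apply: lerD; [exact: ZB|rewrite absv_distC ltW// lP].
Qed.

End spread_interpolation.

(** * Power series in several variables *)

Section box_sums.
Context {d : nat}.

Definition box_index (L : nat) (f : {ffun 'I_d -> 'I_L}) : multi_index d :=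
  [ffun i => val (f i)].

(** Boxes of exponents are cofinal among finite sets of multi-indices, and their product form lets
    sums factor by variable. *)
Definition box_seq (L : nat) : seq (multi_index d) :=
  [seq box_index f | f <- enum {: {ffun 'I_d -> 'I_L}}].

Lemma box_index_inj L : injective (@box_index L).
Proof.
move=> f g /ffunP fg; apply/ffunP => i.
by apply: val_inj; have := fg i; rewrite !ffunE.
Qed.

Lemma box_seq_uniq L : uniq (box_seq L).
Proof. by rewrite map_inj_uniq ?enum_uniq//; exact: box_index_inj. Qed.

Lemma mem_box_seq L (a : multi_index d) : (a \in box_seq L) = [forall i, (a i < L)%N].
Proof.
apply/mapP/forallP => [[f _ ->] i|aL].
  by rewrite ffunE; exact: ltn_ord.
exists [ffun i => Ordinal (aL i)]; first by rewrite mem_enum.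
by apply/ffunP => i; rewrite !ffunE.
Qed.

Lemma leq_mdegree (a : multi_index d) i : (a i <= mdegree a)%N.
Proof. by rewrite /mdegree (bigD1 i)//= leq_addr. Qed.

Lemma mdegree_box L (a : multi_index d) : (mdegree a < L)%N -> a \in box_seq L.
Proof.
move=> aL; rewrite mem_box_seq; apply/forallP => i.
exact: leq_ltn_trans (leq_mdegree a i) aL.
Qed.

Lemma big_box_seq (S : Type) (idx : S) (op : Monoid.com_law idx) L
    (P : pred (multi_index d)) (g : multi_index d -> S) :
  \big[op/idx]_(a <- box_seq L | P a) g a =
  \big[op/idx]_(f : {ffun 'I_d -> 'I_L} | P (box_index f)) g (box_index f).
Proof. by rewrite /box_seq big_map big_enum_cond. Qed.

Lemma multi_index_box (s : seq (multi_index d)) :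
  exists L, {subset s <= box_seq L}.
Proof.
exists (\max_(a <- s) mdegree a).+1 => a sa; apply: mdegree_box.
by rewrite ltnS; exact: leq_bigmax_seq.
Qed.

End box_sums.

#[local] Existing Instance summability.totally_filter.

Section power_series_tails.
Context {R : realType}.

Lemma ler_sum_subseq (T : eqType) (s t : seq T) (g : T -> R) :
  uniq s -> uniq t -> {subset s <= t} -> (forall x, 0 <= g x) ->
  \sum_(x <- s) g x <= \sum_(x <- t) g x.
Proof.
move=> us ut st g0; rewrite [leRHS](bigID (mem s) xpredT)/= -[X in _ <= X + _]big_filter.
rewrite [X in _ <= X + _](perm_big s)/=; first by rewrite lerDl sumr_ge0.
apply: uniq_perm; rewrite ?filter_uniq// => x; rewrite mem_filter.
by apply/andP/idP => [[]//|xs]; split => //; exact: st.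
Qed.

(** Over a box the sum is a product of [d] geometric sums, each at most [2]. *)
Lemma sum_half_mdegree (d : nat) (s : seq (multi_index d)) : uniq s ->
  \sum_(a <- s) 2^-1 ^+ mdegree a <= 2 ^+ d :> R.
Proof.
move=> us; have [L sL] := multi_index_box s.
apply: (@le_trans _ _ (\sum_(a <- box_seq L) 2^-1 ^+ mdegree a)).
  by apply: ler_sum_subseq => //; exact: box_seq_uniq.
rewrite big_box_seq (eq_bigr (fun f : {ffun 'I_d -> 'I_L} =>
    \prod_i 2^-1 ^+ f i)); last first.
  by move=> f _; rewrite /mdegree -prodrXr; apply: eq_bigr => i _; rewrite ffunE.
rewrite -(bigA_distr_bigA (fun _ (j : 'I_L) => 2^-1 ^+ j)) prodr_const card_ord.
rewrite lerXn2r ?nnegrE ?sumr_ge0//.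
suff -> : \sum_(j < L) (2^-1 : R) ^+ j = 2 - 2 * 2^-1 ^+ L.
  by rewrite gerBl mulr_ge0// exprn_ge0// invr_ge0.
elim: L {us sL} => [|L IH]; first by rewrite big_ord0 expr0; lra.
rewrite big_ord_recr/= IH exprS; lra.
Qed.

Context {F : normedFieldType R} {d : nat}.
Implicit Types (g : multi_index d -> F).

Definition dominated g (B r : R) : Prop := forall a, absv (g a) <= B * r ^+ mdegree a.

(** Outside the box the degree is at least [L]. As [2 * r <= 1], the power of [r] is then at most
    [(2 * r) ^+ L] times the same power of [2^-1], and the latter powers are summable. *)
Lemma dominated_tail g (B r : R) (L : nat) (s : seq (multi_index d)) :
  dominated g B r -> 0 <= B -> 0 <= r -> r <= 2^-1 -> uniq s ->
  {subset box_seq L <= s} ->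
  absv (\sum_(a <- s) g a - \sum_(a <- box_seq L) g a) <= B * (2 * r) ^+ L * 2 ^+ d.
Proof.
move=> gB B0 r0 r1 us Ls.
rewrite (bigID (mem (box_seq L)) xpredT)/= addrAC -[X in X - _ + _]big_filter.
rewrite [X in X - _ + _](perm_big (box_seq L))/=; last first.
  apply: uniq_perm; rewrite ?filter_uniq ?box_seq_uniq// => x; rewrite mem_filter.
  by apply/andP/idP => [[]//|xL]; split => //; exact: Ls.
rewrite subrr add0r; apply: le_trans (ler_absv_sum _ _ _) _.
apply: (@le_trans _ _ (\sum_(a <- s) B * (2 * r) ^+ L * 2^-1 ^+ mdegree a)); last first.
  rewrite -mulr_sumr ler_wpM2l ?sum_half_mdegree// mulr_ge0// exprn_ge0// mulr_ge0//.
rewrite big_mkcond/=; apply: ler_sum => a _.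
case: ifPn => [aL|_]; last by rewrite !mulr_ge0 ?exprn_ge0 ?invr_ge0 ?mulr_ge0.
apply: le_trans (gB a) _; rewrite -mulrA ler_wpM2l//.
have La : (L <= mdegree a)%N by rewrite leqNgt; apply: contra aL => /mdegree_box.
rewrite -(subnK La) exprD [in leRHS]exprD mulrCA -exprMn.
rewrite [2 * r * _]mulrAC divff// mul1r ler_wpM2r ?exprn_ge0//.
by rewrite lerXn2r ?nnegrE ?invr_ge0.
Qed.

Lemma pseries_sumP (c : multi_index d -> F) x (s : F) :
  pseries_sum c x s <-> forall e : R, 0 < e -> exists J : {fset (multi_index d)},
    forall J' : {fset (multi_index d)}, (J `<=` J')%fset ->
    absv (\sum_(a <- J') c a * mmonomial a x - s) < e.
Proof.
rewrite /pseries_sum; split=> [/cvg_ballP cs e e0|cs].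
  have [J _ JP] := cs _ e0; exists J => J' JJ'.
  have := JP J' JJ'; rewrite /= /ball/= /absv_dist absv_distC.
  by rewrite /summability.partial_sum big_seq_fsetE.
apply/cvg_ballP => e e0; have [J JP] := cs _ e0; exists J => // J' JJ'.
have := JP J' JJ'.
by rewrite /= /ball/= /absv_dist absv_distC /summability.partial_sum big_seq_fsetE.
Qed.

Lemma pseries_sum_tail (c : multi_index d -> F) x (s : F) (B r : R) (L : nat) :
  pseries_sum c x s -> dominated (fun a => c a * mmonomial a x) B r ->
  0 <= B -> 0 <= r -> r <= 2^-1 ->
  absv (s - \sum_(a <- box_seq L) c a * mmonomial a x) <= B * (2 * r) ^+ L * 2 ^+ d.
Proof.
move=> /pseries_sumP cs cB B0 r0 r1; apply/ler_addgt0Pr => e e0.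
have [J JP] := cs _ e0.
pose J' := (J `|` [fset a in box_seq L])%fset.
have JJ' : (J `<=` J')%fset by exact: fsubsetUl.
have LJ' : {subset box_seq L <= J'}.
  by move=> a aL; rewrite inE; apply/orP; right; rewrite inE.
have H := dominated_tail cB B0 r0 r1 (fset_uniq J') LJ'.
have {}JP := JP J' JJ'.
set S := \sum_(a <- J') _ in H JP; set T := \sum_(a <- box_seq L) _ in H *.
have -> : s - T = (S - T) - (S - s) by ring.
by apply: le_trans (ler_absvB _ _) _; apply: lerD => //; exact: ltW.
Qed.

(** The box sums are Cauchy, so completeness gives a limit; the tail estimate extends the
    convergence to all finite sets containing a large box. *)
Lemma dominated_pseries_cvg (c : multi_index d -> F) x (B : R) :
  complete_normed_field F -> 0 <= B ->
  dominated (fun a => c a * mmonomial a x) B 4^-1 -> pseries_cvg c x.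
Proof.
move=> Fc B0 cB.
have q0 : 0 <= 4^-1 :> R by rewrite invr_ge0.
have q1 : 4^-1 <= 2^-1 :> R by rewrite lef_pV2 ?posrE//; lra.
pose S L := \sum_(a <- box_seq L) c a * mmonomial a x.
have tail (e : R) : 0 < e -> exists L : nat,
      forall M, (L <= M)%N -> B * (2 * 4^-1) ^+ M * 2 ^+ d < e.
  move=> e0; have z1 : `|2^-1 : R| < 1.
    by rewrite ger0_norm ?invr_ge0// invf_lt1// ltr1n.
  have := @cvg_geometric R (B * 2 ^+ d) _ z1.
  move=> /cvgrPdist_lt/(_ e e0)[L _ LP].
  exists L => M /LP; rewrite /= sub0r normrN => /(le_lt_trans (ler_norm _)).
  rewrite (_ : 2 * 4^-1 = 2^-1 :> R) 1?mulrAC//.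
  by apply: (mulIf (x := 4)); [lra|rewrite -mulrA mulVf; lra].
have S_cauchy : cauchy (S @ \oo).
  apply: cauchy_exP => e e0; have [L LP] := tail _ e0.
  exists (S L); exists L => //= L' LL'.
  rewrite /ball/= /absv_dist absv_distC; apply: le_lt_trans (LP L (leqnn L)).
  apply: dominated_tail => //; first exact: box_seq_uniq.
  move=> a; rewrite !mem_box_seq => /forallP aL; apply/forallP => i.
  exact: leq_trans (aL i) LL'.
have /cvg_ex[/= s sP] := Fc S S_cauchy; exists s.
apply/pseries_sumP => e e0.
have e2 : 0 < e / 2 by rewrite divr_gt0.
have [L LP] := tail _ e2.
have /cvg_ballP/(_ _ e2)[N _ NP] := sP.
pose M := maxn N L; have SM := NP M (leq_maxl _ _).
exists [fset a in box_seq M]%fset => J MJ.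
set T := \sum_(a <- J) _.
have -> : T - s = (T - S M) + (S M - s) by rewrite addrA subrK.
apply: le_lt_trans (ler_absvD _ _) _; rewrite [e]splitr ltrD//; last first.
  by rewrite absv_distC.
apply: le_lt_trans (LP M (leq_maxr _ _)).
apply: dominated_tail => //; first exact: fset_uniq.
by move=> a aM; apply: (fsubsetP MJ); rewrite inE.
Qed.

End power_series_tails.

(** * Homogeneous parts and restriction to lines *)

Section homogeneous_parts.
Context {R : realType} {F : normedFieldType R} {d : nat}.
Implicit Types (c : multi_index d -> F) (x : 'rV[F]_d).

Lemma mmonomialZ (a : multi_index d) (t : F) x :
  mmonomial a (t *: x) = t ^+ mdegree a * mmonomial a x.
Proof.
rewrite /mmonomial /mdegree -prodrXr -big_split/=.
by apply: eq_bigr => i _; rewrite mxE exprMn.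
Qed.

(** The homogeneous part of degree [m]; the box [box_seq m.+1] contains every exponent of that
    degree. *)
Definition hpart c m x : F :=
  \sum_(a <- box_seq m.+1 | mdegree a == m) c a * mmonomial a x.

Lemma hpart_box c m x L : (m < L)%N ->
  hpart c m x = \sum_(a <- box_seq L | mdegree a == m) c a * mmonomial a x.
Proof.
move=> mL; rewrite /hpart -big_filter -[RHS]big_filter; apply: perm_big.
apply: uniq_perm; rewrite ?filter_uniq ?box_seq_uniq// => a.
by rewrite !mem_filter; case: eqP => //= am; rewrite !mdegree_box ?am.
Qed.

Lemma hpartZ c m (t : F) x : hpart c m (t *: x) = t ^+ m * hpart c m x.
Proof.
rewrite /hpart mulr_sumr; apply: eq_bigr => a /eqP am.
by rewrite mmonomialZ am mulrCA.
Qed.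

Lemma taylor_poly_hpart c n x : taylor_poly c n x = \sum_(m < n.+1) hpart c m x.
Proof.
rewrite /taylor_poly.
rewrite (fsbig_fwiden [seq a <- box_seq n.+1 | (mdegree a <= n)%N])
  ?filter_uniq ?box_seq_uniq//; last 2 first.
- by move=> a /= an; rewrite mem_filter an mdegree_box.
- by move=> a [/=]; rewrite mem_filter => /andP[].
rewrite big_filter.
rewrite (partition_big (fun a : multi_index d => inord (mdegree a) : 'I_n.+1) xpredT)//=.
apply: eq_bigr => m _; rewrite (hpart_box _ _ (ltn_ord m)); apply: eq_bigl => a.
apply/andP/eqP => [[]|am].
  by rewrite -ltnS => an /eqP/(congr1 val) /=; rewrite inordK.
rewrite am -ltnS ltn_ord; split => //; apply/eqP/val_inj.
by rewrite /= inordK.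
Qed.

End homogeneous_parts.

Section affine_coordinates.
Context {R : realType} {F : normedFieldType R} {k : nat}.
Implicit Types (c : multi_index k.+1 -> F) (x : 'rV[F]_k.+1).

(* At most one [t] contributes: the exponent of [x 0 ord0] completing [a] to
   degree [m]. *)
Definition affine_coef c m (a : {ffun 'I_k -> 'I_m.+1}) : F :=
  \sum_(t < m.+1 | (t + \sum_i a i == m)%N) c (box_index (ffun_cons t a)).

(** Dehomogenization: the quotients are the affine coordinates in which [spread_set] measures
    directions. *)
Lemma hpart_affine c m x : x 0 ord0 != 0 ->
  hpart c m x = x 0 ord0 ^+ m *
    \sum_(a : {ffun 'I_k -> 'I_m.+1}) affine_coef c a * \prod_i (x 0 (lift ord0 i) / x 0 ord0) ^+ a i.
Proof.
move=> x0; rewrite /hpart big_box_seq big_mkcond big_ffun_cons exchange_big/=.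
rewrite mulr_sumr; apply: eq_bigr => a _.
rewrite /affine_coef mulr_suml mulr_sumr [RHS]big_mkcond/=; apply: eq_bigr => t _.
have -> : mdegree (box_index (ffun_cons t a)) = (t + \sum_i a i)%N.
  rewrite /mdegree big_ord_recl ffunE ffun_cons0; congr (_ + _)%N.
  by apply: eq_bigr => i _; rewrite ffunE ffun_consS.
case: eqP => // tam; rewrite mulrCA; congr (_ * _).
rewrite /mmonomial big_ord_recl ffunE ffun_cons0.
rewrite (eq_bigr (fun i => (x 0 (lift ord0 i) / x 0 ord0) ^+ a i * x 0 ord0 ^+ a i)).
  by rewrite big_split/= prodrXr -[X in _ = _ ^+ X * _]tam exprD; ring.
by move=> i _; rewrite ffunE ffun_consS -exprMn divfK.
Qed.

(** The degree determines the exponent of the first variable, so dehomogenizing loses no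
    coefficient. *)
Lemma affine_coef_mdegree c (a : multi_index k.+1) :
  exists b : {ffun 'I_k -> 'I_(mdegree a).+1}, affine_coef c b = c a.
Proof.
set m := mdegree a.
have am i : (a i < m.+1)%N by rewrite ltnS leq_mdegree.
exists [ffun i => Ordinal (am (lift ord0 i))].
have aE : m = (a ord0 + \sum_i a (lift ord0 i))%N by rewrite /m /mdegree big_ord_recl.
have mE v : (v + \sum_i a (lift ord0 i) == m)%N = (v == a ord0).
  by rewrite aE eqn_add2r.
rewrite /affine_coef (big_pred1 (Ordinal (am ord0))) => [|t].
  congr c; apply/ffunP => i; rewrite ffunE.
  by case: (unliftP ord0 i) => [j ->|->]; rewrite ?ffun_cons0// ffun_consS ffunE.
have -> : (\sum_i [ffun i => Ordinal (am (lift ord0 i))] i =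
    \sum_i a (lift ord0 i))%N by apply: eq_bigr => i _; rewrite ffunE.
exact: mE.
Qed.

End affine_coordinates.

Section one_variable.
Context {R : realType} {F : normedFieldType R}.

Lemma box_sum1 (b : multi_index 1 -> F) (t : 'rV[F]_1) (n : nat) :
  \sum_(a <- box_seq n) b a * mmonomial a t =
  \sum_(j < n) b [ffun=> val j] * t 0 0 ^+ j.
Proof.
rewrite big_box_seq big_ffun_cons/=; apply: eq_bigr => j _.
have e : {ffun 'I_0 -> 'I_n} by apply: finfun => -[].
rewrite (big_pred1 e) => [|a]; last by apply/esym/eqP/ffunP => -[].
rewrite /mmonomial big_ord1 ffunE ffun_cons0; congr (b _ * _).
apply/ffunP => i; rewrite (ord1 i) ffunE [RHS]ffunE.
exact: (congr1 (@nat_of_ord _) (ffun_cons0 j e)).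
Qed.

Lemma exists_absv_lt (w : F) (r : R) : 0 < absv w -> absv w < 1 -> 0 < r ->
  exists2 t : F, 0 < absv t & absv t < r.
Proof.
move=> w0 w1 r0; have w1' : `|absv w| < 1 by rewrite ger0_norm// ltW.
have /cvgrPdist_lt/(_ r r0)[l _ lP] := @cvg_geometric R 1 _ w1'.
exists (w ^+ l); rewrite absvX; first by rewrite exprn_gt0.
have := lP l (leqnn l).
by rewrite /= sub0r normrN mul1r ger0_norm// exprn_ge0// ltW.
Qed.

Lemma small_polynomial_eq0 (w : F) (p : nat -> F) :
  0 < absv w -> absv w < 1 ->
  (forall n (e : R), 0 < e -> exists2 r : R, 0 < r &
    forall t : F, absv t < r -> absv (\sum_(j < n.+1) p j * t ^+ j) <= e * absv t ^+ n) ->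
  forall j, p j = 0.
Proof.
move=> w0 w1 psmall j; elim/ltn_ind: j => n IH.
apply/eqP; rewrite -absv_eq0 eq_le absv_ge0 andbT; apply/ler_addgt0Pr => e e0.
have [r r0 rP] := psmall n e e0; rewrite add0r.
have [t t0] := exists_absv_lt w0 w1 r0.
move=> /rP; rewrite big_ord_recr/= big1 => [|i _]; last by rewrite IH// mul0r.
by rewrite add0r absvM absvX ler_pM2r// exprn_gt0.
Qed.

End one_variable.

Section rows.
Context {R : realType} {F : normedFieldType R} {d : nat}.

Lemma max_absv_lt (x : 'rV[F]_d) (e : R) : 0 < e ->
  (forall i, absv (x 0 i) < e) -> max_absv x < e.
Proof.
by move=> e0 xe; rewrite /max_absv; elim/big_ind: _ => // a b ae be; rewrite gt_max ae.
Qed.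

Lemma le_max_absv (x : 'rV[F]_d) i : absv (x 0 i) <= max_absv x.
Proof. exact: (le_bigmax _ (fun i => absv (x 0 i))). Qed.

Lemma near_rowP (u : 'rV[F]_d) (P : set 'rV[F]_d) :
  (\forall y \near u, P y) <->
  exists2 e : R, 0 < e & forall y, max_absv (y - u) < e -> P y.
Proof.
split=> [/nbhs_ballP[e /= e0 eP]|[e e0 eP]].
  exists e => // y yu; apply: eP; split=> // i j.
  rewrite (ord1 i) /ball/= /absv_dist absv_distC; apply: le_lt_trans yu.
  by have := le_max_absv (y - u) j; rewrite !mxE.
apply/nbhs_ballP; exists e => //= y [_ uy]; apply: eP; apply: max_absv_lt => // i.
by have := uy 0 i; rewrite /ball/= /absv_dist absv_distC !mxE.
Qed.

Lemma max_absv_ge0 (x : 'rV[F]_d) : 0 <= max_absv x.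
Proof. exact: bigmax_ge_id. Qed.

Lemma max_absvZ (t : F) (x : 'rV[F]_d) : max_absv (t *: x) = absv t * max_absv x.
Proof.
rewrite /max_absv; elim/big_rec2: _ => [|i a b _ ->]; first by rewrite mulr0.
by rewrite mxE absvM maxr_pMr// absv_ge0.
Qed.

End rows.

Section analytic_lines.
Context {R : realType} {F : normedFieldType R}.

(** A term outside [J] is the difference of two partial sums within [1] of [s]; a term inside is at
    most the sum of the norms over [J]. *)
Lemma pseries_sum_bounded (d : nat) (c : multi_index d -> F) (x : 'rV[F]_d) (s : F) :
  pseries_sum c x s -> exists2 B : R, 0 <= B & forall a, absv (c a * mmonomial a x) <= B.
Proof.
move=> /pseries_sumP/(_ 1 ltr01)[J JP].
pose g a := absv (c a * mmonomial a x).
have g0 a : 0 <= g a by exact: absv_ge0.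
exists (\sum_(a <- J) g a + 2); first by rewrite addr_ge0// sumr_ge0.
move=> a; rewrite -/(g a); have [aJ|aJ] := boolP (a \in J).
  by rewrite (big_fsetD1 a)//= -addrA lerDl addr_ge0// sumr_ge0.
rewrite -[g a]add0r; apply: lerD; first exact: sumr_ge0.
have := JP (a |` J)%fset (fsubsetU1 _ _); rewrite big_fsetU1//=.
have := JP J (fsubset_refl _); set T := \sum_(b <- J) _ => h1 h2.
rewrite /g; set t := c a * _ in h2 *.
have -> : t = (t + T - s) - (T - s) by ring.
apply: le_trans (ler_absvB _ _) _; lra.
Qed.

(** Along the line, the convergent series [b] and the Taylor polynomials approximate the same
    function to every order, so the coefficients of [b] are the values [hpart c m x]. The terms of
    [b] at a nonzero point [t0] are bounded, and [rho] is the norm of [t0]. *)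
Lemma hpart_line_bound (w : F) (d : nat) (f : 'rV[F]_d -> F) u
    (c : multi_index d -> F) x :
  0 < absv w -> absv w < 1 -> taylor_series f u c ->
  analytic_at (fun t : 'rV[F]_1 => f (u + t 0 0 *: x)) 0 ->
  exists B rho : R, [/\ 0 <= B, 0 < rho &
    forall m, absv (hpart c m x) * rho ^+ m <= B].
Proof.
move=> w0 w1 fc [b /near_rowP[r0 r00 r0P]].
pose row t : 'rV[F]_1 := const_mx t.
have bt t : absv t < r0 -> pseries_sum b (row t) (f (u + t *: x)).
  move=> tr; have := r0P (row t); rewrite !subr0 mxE; apply.
  by apply: max_absv_lt => // i; rewrite mxE.
have [t0 t00 t0r] := exists_absv_lt w0 w1 r00.
have [B B0 BP] := pseries_sum_bounded (bt t0 t0r).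
set rho := absv t0 in t00 t0r.
have monE a t : mmonomial a (row t) = t ^+ mdegree a.
  by rewrite /mmonomial /mdegree !big_ord1 mxE.
have dom t : dominated (fun a => b a * mmonomial a (row t)) B (absv t / rho).
  move=> a; have := BP a; rewrite !monE !absvM !absvX -/rho.
  rewrite exprMn exprVn mulrCA => h; rewrite mulrC ler_wpM2l ?exprn_ge0 ?absv_ge0//.
  by rewrite ler_pdivlMr ?exprn_gt0.
(* The remainder carries one more power of [absv t], which makes it small compared with
   [absv t ^+ n]. *)
have tail n t : absv t < r0 -> absv t <= rho / 2 ->
    absv (f (u + t *: x) - \sum_(j < n.+1) b [ffun=> val j] * t ^+ j) <=
    (2 * B * (2 / rho) ^+ n.+1 * absv t) * absv t ^+ n.
  move=> tr0 trho.
  have := pseries_sum_tail n.+1 (bt t tr0) (dom t) B0.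
  rewrite box_sum1 mxE divr_ge0 ?absv_ge0 ?(ltW t00)// => /(_ isT).
  rewrite ler_pdivrMr// mulrC => /(_ trho) /le_trans; apply.
  rewrite [leRHS](_ : _ = B * (2 * (absv t / rho)) ^+ n.+1 * 2 ^+ 1)//.
  by rewrite !exprMn expr1 [absv t ^+ n.+1]exprS; ring.
pose p j := b [ffun=> j] - hpart c j x.
have p0 : forall j, p j = 0.
  apply: (small_polynomial_eq0 w0 w1) => n e e0.
  set mx := max_absv x; have mx0 : 0 <= mx by exact: max_absv_ge0.
  pose e1 := e / 2 / (mx ^+ n + 1).
  have mxn : 0 <= mx ^+ n by rewrite exprn_ge0.
  have e10 : 0 < e1 by rewrite !divr_gt0//; lra.
  have /near_rowP[r1 r10 r1P] := fc n e1 e10.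
  pose D := 2 * B * (2 / rho) ^+ n.+1.
  have D0 : 0 <= D by rewrite !mulr_ge0// exprn_ge0// divr_ge0// ltW.
  (* The four bounds ensure, in order, convergence of [b], domination with ratio at most [2^-1], the
     Taylor estimate, and a tail below half of [e]. *)
  exists (Num.min (Num.min r0 (rho / 2)) (Num.min (r1 / (mx + 1)) (e / 2 / (D + 1)))).
    rewrite !lt_min r00 !divr_gt0//; lra.
  move=> t; rewrite !lt_min => /andP[/andP[tr0 trho] /andP[tr1 tD]].
  have tail_t := tail n t tr0 (ltW trho).
  have taylor_t : absv (f (u + t *: x) - taylor_poly c n (t *: x)) <= e / 2 * absv t ^+ n.
    apply: le_trans (r1P _ _) _; rewrite ?subr0 max_absvZ -/mx.
      apply: le_lt_trans (_ : absv t * (mx + 1) < r1); last first.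
        by rewrite -ltr_pdivlMr//; lra.
      by rewrite ler_wpM2l ?absv_ge0//; lra.
    rewrite exprMn mulrCA mulrC ler_wpM2r ?exprn_ge0 ?absv_ge0//.
    by rewrite /e1 mulrAC ler_pdivrMr ?ler_wpM2l//; lra.
  have -> : \sum_(j < n.+1) p j * t ^+ j =
      (f (u + t *: x) - taylor_poly c n (t *: x)) -
      (f (u + t *: x) - \sum_(j < n.+1) b [ffun=> val j] * t ^+ j).
    rewrite opprB addrC addrA addrNK taylor_poly_hpart -sumrB.
    by apply: eq_bigr => j _; rewrite hpartZ /p mulrBl [hpart _ _ _ * _]mulrC.
  apply: le_trans (ler_absvB _ _) _.
  rewrite [e in leRHS]splitr mulrDl; apply: lerD => //.
  apply: le_trans tail_t _; rewrite -/D ler_wpM2r ?exprn_ge0 ?absv_ge0//.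
  apply: le_trans (_ : (D + 1) * absv t <= _).
    by rewrite ler_wpM2r ?absv_ge0//; lra.
  by rewrite mulrC -ler_pdivlMr ?ltW//; lra.
exists B, rho; split => // m.
have /eqP := p0 m; rewrite subr_eq0 => /eqP <-.
by have := BP [ffun=> m]; rewrite monE /mdegree big_ord1 ffunE absvM absvX.
Qed.

End analytic_lines.

(** * Geometric growth of the Taylor coefficients *)

Section coefficient_growth.
Context {R : realType} {F : normedFieldType R}.

Lemma ereal_gt0_lb (x : \bar R) : (0 < x)%E ->
  exists2 e : R, 0 < e & (e%:E <= x)%E.
Proof.
case: x => [r|_|]//; last by exists 1; rewrite ?ltr01 ?leey.
by rewrite lte_fin => r0; exists r.
Qed.

Lemma powD1_le (N : R) m : 0 <= N -> N ^+ m.+1 + 1 <= (N + 1) ^+ m.+1.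
Proof.
move=> N0; rewrite !exprS mulrDl mul1r; apply: lerD.
  by rewrite ler_wpM2l// lerXn2r ?nnegrE ?addr_ge0// lerDl.
by rewrite exprn_ege1// lerDr.
Qed.

(** The sets [Z N] cover the preimage of the spread set, so one of them has positive outer measure;
    on it the bound is uniform in the direction and [spread_coef_bound] applies. *)
Lemma spread_hpart_growth (k : nat) (X : set 'rV[F]_k.+1)
    (c : multi_index k.+1 -> F) :
  spread_set X ->
  (forall x, X x -> exists B rho : R, [/\ 0 <= B, 0 < rho &
    forall m, absv (hpart c m x) * rho ^+ m <= B]) ->
  exists2 M : R, 0 <= M & forall a, absv (c a) <= M ^+ (mdegree a).+1.
Proof.
case=> iota iota_spread Y0 cX.
pose val_at (xi : 'I_k -> cantor_space) m : F :=
  \sum_(a : {ffun 'I_k -> 'I_m.+1}) affine_coef c a * \prod_i iota i (xi i) ^+ a i.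
pose Z (N : nat) := [set xi | forall m, absv (val_at xi m) <= N%:R ^+ m.+1].
have [N ZN] : exists N, (0 < @cantor_outer_measure R k (Z N))%E.
  apply: contrapT => nN; move: Y0; rewrite ltNge => /negP; apply.
  apply: (cantor_outer_measure_bigcup0 (Z := Z)); last first.
    by move=> N; rewrite leNgt; apply/negP => h; apply: nN; exists N.
  move=> xi /= [x [Xx x0] xE].
  have [B [rho [B0 rho0 BP]]] := cX x Xx.
  set x00 := absv (x 0 ord0).
  have x00_gt0 : 0 < x00 by rewrite absv_gt0.
  have q0 : 0 < (rho * x00)^-1 by rewrite invr_gt0 mulr_gt0.
  (* This [N] dominates both [B] and the ratio [(rho * x00)^-1], hence [B] times the [m]-th power of
     that ratio is at most [N%:R ^+ m.+1]. *)
  pose N := (Num.truncn (B + (rho * x00)^-1)).+1.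
  have NP : B + (rho * x00)^-1 <= N%:R by rewrite ltW// truncnS_gt.
  exists N => // m.
  have hE : hpart c m x = x 0 ord0 ^+ m * val_at xi m.
    rewrite hpart_affine//; congr (_ * _); apply: eq_bigr => a _; congr (_ * _).
    apply: eq_bigr => i _; congr (_ ^+ _).
    by have /rowP/(_ i) := xE; rewrite !mxE.
  have := BP m; rewrite hE absvM absvX -/x00 mulrAC -exprMn mulrC [x00 * rho]mulrC.
  rewrite -ler_pdivlMr ?exprn_gt0 ?mulr_gt0// -exprVn => /le_trans; apply.
  rewrite exprS; apply: ler_pM => //; first by rewrite exprn_ge0// ltW.
    by apply: le_trans NP; rewrite lerDl ltW.
  rewrite lerXn2r ?nnegrE ?(ltW q0)//.
  by apply: le_trans NP; rewrite lerDr.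
have [delta d0 dZ] := ereal_gt0_lb ZN.
have [K K0 KP] := spread_coef_bound iota_spread d0 dZ.
exists (K ^+ k * (N%:R + 1)); first by rewrite mulr_ge0 ?exprn_ge0 ?addr_ge0.
move=> a; have [b <-] := affine_coef_mdegree c a.
set m := mdegree a in b *.
apply: le_trans (KP m (@affine_coef R F k c m) (N%:R ^+ m.+1) _ _ b) _.
- by rewrite exprn_ge0.
- by move=> xi /(_ m).
by rewrite exprMn -!exprM mulnC ler_wpM2l ?exprn_ge0// powD1_le.
Qed.

Lemma growth_dominated (d : nat) (c : multi_index d -> F) (M : R) (x : 'rV[F]_d) :
  0 <= M -> (forall a, absv (c a) <= M ^+ (mdegree a).+1) ->
  M * max_absv x <= 4^-1 ->
  dominated (fun a => c a * mmonomial a x) M 4^-1.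
Proof.
move=> M0 cM Mx a; rewrite absvM.
apply: le_trans (_ : M ^+ (mdegree a).+1 * max_absv x ^+ mdegree a <= _).
  apply: ler_pM; rewrite ?absv_ge0//.
  rewrite /mmonomial absv_prod /mdegree -prodrXr; apply: ler_prod => i _.
  rewrite absv_ge0 absvX lerXn2r ?nnegrE ?absv_ge0 ?max_absv_ge0//.
  exact: le_max_absv.
rewrite exprS -mulrA -exprMn ler_wpM2l// lerXn2r ?nnegrE ?invr_ge0//.
by rewrite mulr_ge0 ?max_absv_ge0.
Qed.

(** Applying the hypothesis to [x^-1] gives the upper bound. *)
Lemma trivial_absv (x : F) :
  (forall w : F, 0 < absv w -> 1 <= absv w) -> absv x <= 1.
Proof.
move=> triv; have [->|x0] := eqVneq x 0; first by rewrite absv0.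
have := triv x^-1; rewrite absvV invr_gt0 absv_gt0 => /(_ x0).
by rewrite invf_ge1// absv_gt0.
Qed.

End coefficient_growth.

Theorem corollary6p1 (R : realType) (F : normedFieldType R) (k : nat)
    (S : smoothSheaf F k.+1) :
  complete_normed_field F -> gentric S ->
  forall U : set 'rV[F]_k.+1, open U ->
  forall f : 'rV[F]_k.+1 -> F, S U f -> analytic_on U f.
Proof.
move=> Fc [Spre [X Xspread Xan]] U Uo f Uf u Uu.
have [c fc] := sections_smooth Uo Uf Uu.
have [M M0 cM] : exists2 M : R, 0 <= M & forall a, absv (c a) <= M ^+ (mdegree a).+1.
  (* Comparing expansions along lines requires arbitrarily small nonzero scalars. If there are none,
     the norm is trivial and [M = 1] bounds all coefficients. *)
  have [[w [w0 w1]]|triv] := pselect (exists w : F, 0 < absv w /\ absv w < 1).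
    apply: (spread_hpart_growth Xspread) => x Xx.
    exact: hpart_line_bound w0 w1 fc (nbhs_singleton (Xan U u f x Uo Uu Uf Xx)).
  exists 1 => // a; rewrite expr1n; apply: trivial_absv => w w0.
  by rewrite leNgt; apply/negP => w1; apply: triv; exists w.
(* Within this radius [M * max_absv (y - u) <= 4^-1], as [growth_dominated] demands. *)
pose r := 4^-1 / (M + 1).
have r0 : 0 < r by rewrite divr_gt0 ?invr_gt0//; lra.
(* The pre-gentric property requires convergence on the whole open set, so [f] is first restricted
   to [V]. *)
pose V := U `&` [set y | max_absv (y - u) < r]°.
have Vo : open V by apply: openI => //; exact: open_interior.
have Vu : V u by split => //; apply/near_rowP; exists r.
have VU : V `<=` U by move=> y [].
have Vf : S V f := sections_restrict Uo Vo VU Uf.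
exists c; apply: filterS (open_nbhs_nbhs (conj Vo Vu)).
apply: (Spre V u f c Vo Vu Vf fc) => y [_ /interior_subset/= yr].
apply: (dominated_pseries_cvg Fc M0); apply: growth_dominated => //.
apply: le_trans (_ : (M + 1) * r <= _).
  by apply: ler_pM; rewrite ?max_absv_ge0 ?(ltW yr)//; lra.
by rewrite /r mulrC divfK//; lra.
Qed.
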